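(* Let $n\ge 1$, let $f\colon\mathbb{R}^n\to\mathbb{R}^+$ be a positive-valued continuous function, and let $$K=\{(t,0)\in\mathbb{R}^{n+1}\mid t\in\mathbb{R}^n\},\qquad L=\{(t,f(t))\in\mathbb{R}^{n+1}\mid t\in\mathbb{R}^n\}.$$ Then for any $x\in\mathbb{R}^n$ there is a uniquely determined positive real number $G(x)$ such that $$d((x,G(x)),L)=d((x,G(x)),K).$$ Moreover, for every $y\in\mathbb{R}$, the inequality $G(x)<y$ implies $d((x,y),L)<d((x,y),K)$, and the inequality $y<G(x)$ implies $d((x,y),K)<d((x,y),L)$.
   Context: $\mathbb{R}^{n+1}$ carries the Euclidean distance $d(p,q)=|p-q|$, and the distance of a point $p$ from a set $S\subset\mathbb{R}^{n+1}$ is $d(p,S)=\inf\{d(p,q)\mid q\in S\}$. $\mathbb{R}^+$ denotes the set of positive real numbers. Points of $\mathbb{R}^{n+1}$ are written $(x,y)$ with $x\in\mathbb{R}^n$, $y\in\mathbb{R}$. *)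

(* Defs.v *)
From mathcomp Require Import all_boot all_order all_algebra.
From mathcomp Require Import all_classical all_reals all_analysis.

Set Implicit Arguments.
Unset Strict Implicit.
Unset Printing Implicit Defensive.

Import Order.TTheory GRing.Theory Num.Theory.
Import numFieldNormedType.Exports.

Local Open Scope classical_set_scope.
Local Open Scope ring_scope.

(* The library norm on row vectors is the sup norm, hence these definitions. *)
Definition eucl_norm (R : realType) (m : nat) (v : 'rV[R]_m) : R :=
  Num.sqrt (\sum_(i < m) v 0 i ^+ 2).

Definition eucl_dist (R : realType) (m : nat) (p q : 'rV[R]_m) : R :=
  eucl_norm (p - q).

(* [inf] takes a junk value (0) on the empty set. *)
Definition set_dist (R : realType) (m : nat) (p : 'rV[R]_m)
    (S : set 'rV[R]_m) : R :=
  inf [set eucl_dist p q | q in S].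

(* The point (x, y) of R^n x R = R^(n+1). *)
Definition pt (R : realType) (n : nat) (x : 'rV[R]_n) (y : R) :
    'rV[R]_(n + 1) :=
  row_mx x (const_mx y).

Definition hyperplane (R : realType) (n : nat) : set 'rV[R]_(n + 1) :=
  [set pt t 0 | t in [set: 'rV[R]_n]].
Arguments hyperplane : clear implicits.

Definition graph_of (R : realType) (n : nat) (f : 'rV[R]_n -> R) :
    set 'rV[R]_(n + 1) :=
  [set pt t (f t) | t in [set: 'rV[R]_n]].

(* Main.v *)
Require Import Defs.
From mathcomp Require Import all_boot all_order all_algebra.
From mathcomp Require Import all_classical all_reals all_analysis.
From mathcomp Require Import ring lra.

Set Implicit Arguments.
Unset Strict Implicit.
Unset Printing Implicit Defensive.

Import Order.TTheory GRing.Theory Num.Theory.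
Import numFieldNormedType.Exports.

Local Open Scope classical_set_scope.
Local Open Scope ring_scope.

(* Points [(x, y)] are compared with [(t, f t)] through the squared distance:
   [d((x,y),(t,f t))^2 - y^2 = 2 f(t) (h(t) - y)] where
   [h(t) = (|x - t|^2 + f(t)^2) / (2 f(t))].  As [h(t) >= |x - t|] by AM-GM,
   the continuous function [h] attains its minimum, which is [G(x)]; likewise
   the distance from [(x, y)] to the graph is attained, so that the sign of
   [y - G(x)] decides strictly between the two distances. *)

Lemma eucl_norm_ge0 (R : realType) m (v : 'rV[R]_m) : 0 <= eucl_norm v.
Proof. exact: sqrtr_ge0. Qed.

Lemma sqr_eucl_norm (R : realType) m (v : 'rV[R]_m) :
  eucl_norm v ^+ 2 = \sum_(i < m) v 0 i ^+ 2.
Proof. by rewrite sqr_sqrtr// sumr_ge0// => i _; exact: sqr_ge0. Qed.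

(** Lets Euclidean estimates yield boundedness in the sup norm, the norm in which compactness is
    stated. *)
Lemma normr_le_eucl_norm (R : realType) m (v : 'rV[R]_m) :
  `|v| <= eucl_norm v.
Proof.
rewrite /Num.norm/= mx_normrE; apply/bigmax_leP.
split=> [|[i j] _ /=]; first exact: eucl_norm_ge0.
rewrite (ord1 i) -sqrtr_sqr ler_wsqrtr// (bigD1 j)//= lerDl.
by rewrite sumr_ge0// => k _; exact: sqr_ge0.
Qed.

Lemma eucl_dist_pt (R : realType) n (x t : 'rV[R]_n) (y z : R) :
  eucl_dist (pt x y) (pt t z) =
  Num.sqrt (eucl_dist x t ^+ 2 + (y - z) ^+ 2).
Proof.
congr Num.sqrt; rewrite sqr_eucl_norm opp_row_mx add_row_mx big_split_ord/=.
congr (_ + _); last by rewrite big_ord1 row_mxEr !mxE.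
by apply: eq_bigr => i _; rewrite row_mxEl.
Qed.

Lemma eucl_dist_pt_hyperplane (R : realType) n (x t : 'rV[R]_n) (y : R) :
  `|y| <= eucl_dist (pt x y) (pt t 0).
Proof.
by rewrite eucl_dist_pt subr0 -sqrtr_sqr ler_wsqrtr// lerDr sqr_ge0.
Qed.

Lemma continuous_eucl_dist (R : realType) m (x : 'rV[R]_m) :
  continuous (eucl_dist x).
Proof.
move=> t; apply: (continuous_comp _ (@sqrt_continuous R _)) => /=.
apply: (cvg_big (@add_continuous R) (nbhs_filter t)) => i _.
under eq_fun do rewrite !mxE.
rewrite !mxE; apply: cvgM; apply: cvgB;
  by [exact: cvg_cst | exact: coord_continuous].
Qed.

Lemma continuous_sqr (R : realType) (T : topologicalType) (g : T -> R) :
  continuous g -> continuous (fun t => g t ^+ 2).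
Proof. by move=> gc t; apply: cvgM; exact: gc. Qed.

(** The sublevel set of [g] at level [g x] is closed by continuity and bounded because [g] dominates
    the distance to [x]. It is thus compact, and a minimum over it is global, since [g] exceeds
    [g x] outside it. *)
Lemma coercive_min (R : realType) m (x : 'rV[R]_m) (g : 'rV[R]_m -> R) :
  continuous g -> (forall t, eucl_dist x t <= g t) ->
  exists t0, forall t, g t0 <= g t.
Proof.
move=> gc gx; pose A := [set t | g t <= g x].
have Ax : A x by rewrite /A/=.
have Ac : compact A.
  apply: bounded_closed_compact.
    exists (`|x| + g x); split; first exact: num_real.
    move=> M xM t /= At; apply: le_trans (ltW xM).
    rewrite -lerBlDl; apply: le_trans At; apply: le_trans (gx t).
    apply: le_trans (normr_le_eucl_norm _).
    by rewrite distrC; exact: lerB_dist.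
  by move/continuous_closedP: gc => /(_ _ (@closed_le R (g x))).
have [|t0 /set_mem At0 t0min] := EVT_min_rV _ Ac (continuous_subspaceT gc).
  by exists x.
exists t0 => t; have [gtx|/ltW gxt] := leP (g t) (g x).
  by apply: t0min; exact: mem_set.
exact: le_trans At0 gxt.
Qed.

Lemma set_dist_min (R : realType) m (p q : 'rV[R]_m) (S : set 'rV[R]_m) :
  S q -> (forall s, S s -> eucl_dist p q <= eucl_dist p s) ->
  set_dist p S = eucl_dist p q.
Proof.
move=> Sq qmin.
have lbd : lbound [set eucl_dist p s | s in S] (eucl_dist p q).
  by move=> _ [s Ss <-]; exact: qmin.
apply/eqP; rewrite eq_le; apply/andP; split.
  by apply: ge_inf; [exists (eucl_dist p q) | exists q].
by apply: lb_le_inf => //; exists (eucl_dist p q), q.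
Qed.

Lemma set_dist_hyperplane (R : realType) n (x : 'rV[R]_n) (y : R) :
  set_dist (pt x y) (hyperplane R n) = `|y|.
Proof.
have yE : eucl_dist (pt x y) (pt x 0) = `|y|.
  rewrite eucl_dist_pt subr0 /eucl_dist subrr sqr_eucl_norm big1 => [|i _].
    by rewrite add0r sqrtr_sqr.
  by rewrite mxE expr0n.
rewrite -yE; apply: set_dist_min; first by exists x.
by move=> _ [t _ <-]; rewrite yE eucl_dist_pt_hyperplane.
Qed.

(** Attainment matters: a strict lower bound on each distance to the graph would pass to a mere
    infimum only as a weak one. *)
Lemma set_dist_graph (R : realType) n (f : 'rV[R]_n -> R) (x : 'rV[R]_n)
    (y : R) : continuous f ->
  exists t0, set_dist (pt x y) (graph_of f) = eucl_dist (pt x y) (pt t0 (f t0))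
    /\ forall t, eucl_dist (pt x y) (pt t0 (f t0)) <=
                 eucl_dist (pt x y) (pt t (f t)).
Proof.
move=> fc; have [||t0 t0min] :=
    @coercive_min _ _ x (fun t => eucl_dist (pt x y) (pt t (f t))).
- rewrite (funext (fun t => eucl_dist_pt x t y (f t))) => t.
  apply: (@continuous_comp _ _ _
    (fun s => eucl_dist x s ^+ 2 + (y - f s) ^+ 2) Num.sqrt); last first.
    exact: sqrt_continuous.
  have dc := continuous_sqr (@continuous_eucl_dist _ _ x).
  have yc : continuous (fun s => (y - f s) ^+ 2).
    by apply: continuous_sqr => s; exact: (cvgB (cvg_cst y) (fc s)).
  exact: (cvgD (dc t) (yc t)).
- move=> t; rewrite eucl_dist_pt -{1}[eucl_dist x t]ger0_norm.
    by rewrite -sqrtr_sqr ler_wsqrtr// lerDl sqr_ge0.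
  exact: eucl_norm_ge0.
- exists t0; split=> //; apply: set_dist_min; first by exists t0.
  by move=> _ [t _ <-].
Qed.

Theorem lemma2 (R : realType) (n : nat) (n_ge1 : (1 <= n)%N)
    (f : 'rV[R]_n -> R) (f_gt0 : forall t : 'rV[R]_n, 0 < f t)
    (f_cont : continuous f) :
  let K := hyperplane R n in
  let L := graph_of f in
  forall x : 'rV[R]_n, exists Gx : R,
    [/\ unique (fun g : R =>
          0 < g /\ set_dist (pt x g) L = set_dist (pt x g) K) Gx,
        forall y : R, Gx < y -> set_dist (pt x y) L < set_dist (pt x y) K
      & forall y : R, y < Gx -> set_dist (pt x y) K < set_dist (pt x y) L].
Proof.
move=> K L x.
(* [h t] is the height at which a point over [x] is equidistant from [pt t (f t)] and the
   hyperplane. *)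
pose h t := (eucl_dist x t ^+ 2 + f t ^+ 2) / (2 * f t).
have f2_gt0 t : 0 < 2 * f t by rewrite mulr_gt0.
have hE y t : eucl_dist x t ^+ 2 + (y - f t) ^+ 2 =
              y ^+ 2 + 2 * f t * (h t - y).
  by rewrite /h; field; rewrite gt_eqF.
have [||m hmin] := @coercive_min _ _ x h.
- move=> t; have dc := continuous_sqr (@continuous_eucl_dist _ _ x).
  have fc2 := continuous_sqr f_cont.
  have f2c : continuous (fun t => 2 * f t).
    by move=> s; exact: (cvgM (cvg_cst (2 : R)) (f_cont s)).
  exact: (cvgM (cvgD (dc t) (fc2 t)) (cvgV (lt0r_neq0 (f2_gt0 t)) (f2c t))).
- move=> t; rewrite /h ler_pdivlMr//.
  by have := sqr_ge0 (eucl_dist x t - f t); lra.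
have hm_gt0 : 0 < h m.
  by rewrite divr_gt0// ltr_wpDl ?sqr_ge0// exprn_gt0.
have sqrtK (y : R) : `|y| = Num.sqrt (y ^+ 2) by rewrite sqrtr_sqr.
have above y : h m < y -> set_dist (pt x y) L < set_dist (pt x y) K.
  move=> my; have [t0 [-> t0min]] := set_dist_graph x y f_cont.
  (* The graph point over [m] alone is already nearer than the hyperplane. *)
  apply: le_lt_trans (t0min m) _.
  rewrite set_dist_hyperplane eucl_dist_pt hE sqrtK ltr_sqrt.
    by rewrite gtrDl pmulr_rlt0// subr_lt0.
  (* Strict monotonicity of the root needs a positive larger radicand, here [y ^+ 2]; this is where
     [0 < h m] enters. *)
  by rewrite exprn_gt0// (lt_trans hm_gt0).
have below y : y < h m -> set_dist (pt x y) K < set_dist (pt x y) L.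
  move=> ym; have [t0 [-> _]] := set_dist_graph x y f_cont.
  (* As [y < h m <= h t0], even the nearest graph point is farther than [K]. The sign of [y] is
     arbitrary, so positivity of the larger radicand also comes from this inequality. *)
  have lt2 : y ^+ 2 < y ^+ 2 + 2 * f t0 * (h t0 - y).
    by rewrite ltrDl mulr_gt0// subr_gt0 (lt_le_trans ym).
  rewrite set_dist_hyperplane eucl_dist_pt hE sqrtK ltr_sqrt//.
  exact: le_lt_trans (sqr_ge0 y) lt2.
exists (h m); split=> //; split.
  split=> //; have [t0 [-> t0min]] := set_dist_graph x (h m) f_cont.
  (* At height [h m] the point over [m] is exactly as far as [K], and [h m <= h t0] shows that the
     nearest graph point is no closer. *)
  rewrite set_dist_hyperplane; apply/eqP; rewrite eq_le; apply/andP; split.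
    apply: le_trans (t0min m) _.
    by rewrite eucl_dist_pt hE subrr mulr0 addr0 sqrtK.
  by rewrite eucl_dist_pt hE sqrtK ler_wsqrtr// lerDl mulr_ge0 ?subr_ge0// ltW.
(* Uniqueness: at any other height one of the strict inequalities contradicts equidistance. *)
move=> g [_ gE]; case: (ltgtP (h m) g) => // [/above|/below];
  by rewrite gE ltxx.
Qed.
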